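(* For all integers $n,m\geq 0$, $$P(n,m) = \#\{(\lambda, \mu)\in \overline{\mathcal A}(n,m)\mid \overline\ell(\lambda) \text{ is even}\}-\#\{(\lambda, \mu)\in \overline{\mathcal A}(n,m)\mid \overline\ell(\lambda) \text{ is odd}\}.$$
   Context: A partition of $n$ is a finite non-increasing sequence of positive integers (its parts) with sum $n$; the only partition of $0$ is the empty one. The missing integers of a partition $\lambda$ are the positive integers less than the largest part of $\lambda$ that do not occur as parts of $\lambda$ (the empty partition has none). $P(n,m)$ denotes the number of partitions of $n$ with exactly $m$ missing integers. $\mathcal P$ is the set of all partitions (including the empty one), and $\ell(\mu)$ is the number of parts of $\mu$, counted with multiplicity. A distinct overpartition is a partition with pairwise distinct parts in which each part may independently be overlined or not; in particular, no part size occurs both overlined and non-overlined. $\overline{\mathcal D}$ is the set of all distinct overpartitions (including the empty one). For $\lambda\in\overline{\mathcal D}$, $\overline\ell(\lambda)$ is the number of overlined parts of $\lambda$. The size $|\lambda|$ is the sum of all parts, ignoring overlines. For $n,m\ge 0$, $$\overline{\mathcal A}(n,m)=\{(\lambda,\mu)\mid \lambda\in\overline{\mathcal D},\ \mu\in\mathcal P,\ |\lambda|+|\mu|=n,\ \overline\ell(\lambda)=m-\ell(\mu)\}.$$ *)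

(* Defs.v *)
From mathcomp Require Import all_boot all_order all_algebra finmap.
From mathcomp Require Import boolp classical_sets functions cardinality.

Set Implicit Arguments.
Unset Strict Implicit.
Unset Printing Implicit Defensive.

Import Order.TTheory GRing.Theory Num.Theory.

Local Open Scope nat_scope.
Local Open Scope classical_set_scope.

Definition is_partition (s : seq nat) : bool :=
  sorted geq s && all (leq 1) s.

Definition missing (s : seq nat) : seq nat :=
  [seq i <- index_iota 1 (\max_(p <- s) p) | i \notin s].

(* Cardinality of a set; [fset_set] sends infinite sets to the empty one, so
   this is only meaningful on finite sets. The lemmas at the end of the file
   show that every set it is used on is finite. *)
Definition ncard (T : choiceType) (A : set T) : nat := #|` fset_set A|.

Definition partitions_missing (n m : nat) : set (seq nat) :=
  [set s | [/\ is_partition s, sumn s = n & size (missing s) = m]].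

Definition P (n m : nat) : nat := ncard (partitions_missing n m).

(* A part of an overpartition is a pair (size, overlined?). Sizes are listed in
   strictly decreasing order, so that no size is repeated, whatever its
   overline status. *)
Definition is_distinct_overpartition (l : seq (nat * bool)) : bool :=
  sorted gtn (unzip1 l) && all (leq 1) (unzip1 l).

Definition overlined (l : seq (nat * bool)) : nat := count snd l.

(* The last equation is between integers: with truncated subtraction it would
   also hold when [overlined l = 0] and [size u > m]. *)
Definition Abar (n m : nat) : set (seq (nat * bool) * seq nat) :=
  [set lu | [/\ is_distinct_overpartition lu.1, is_partition lu.2,
      sumn (unzip1 lu.1) + sumn lu.2 = n
    & ((overlined lu.1)%:Z = m%:Z - (size lu.2)%:Z :> int)%R]].

Definition Abar_even (n m : nat) : set (seq (nat * bool) * seq nat) :=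
  [set lu | Abar n m lu /\ ~~ odd (overlined lu.1)].

Definition Abar_odd (n m : nat) : set (seq (nat * bool) * seq nat) :=
  [set lu | Abar n m lu /\ odd (overlined lu.1)].

Lemma finite_bounded_seq (T : eqType) (F : finType) (g : F -> T) (n : nat)
    (B : pred T) :
  (forall x, B x -> exists y, g y = x) ->
  finite_set [set s : seq T | size s <= n /\ all B s].
Proof.
move=> Bg; pose h (t : {bseq n of F}) := map g t.
apply: (@sub_finite_set _ _ (h @` setT)); last exact/finite_image/finite_finset.
move=> s /= [sn sB].
suff [t ts] : exists t, map g t = s.
  have tn : size t <= n by rewrite -(size_map g) ts.
  by exists (Bseq tn).
elim: s sB {sn} => [_|x s IH /= /andP[/Bg[y <-]]]; first by exists [::].
by move=> /IH[t <-]; exists (y :: t).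
Qed.

Lemma size_le_sumn (s : seq nat) : all (leq 1) s -> size s <= sumn s.
Proof. by elim: s => //= x s IH /andP[x0 /IH]; rewrite -add1n; apply: leq_add. Qed.

Lemma all_le_sumn (s : seq nat) : all (geq (sumn s)) s.
Proof.
elim: s => //= x s /allP IH; rewrite leq_addr /=.
by apply/allP => y /IH /= ys; rewrite (leq_trans ys) ?leq_addl.
Qed.

Lemma finite_partitions_le (n : nat) :
  finite_set [set s | is_partition s /\ sumn s <= n].
Proof.
apply: sub_finite_set (@finite_bounded_seq _ _ (@nat_of_ord n.+1) n (geq n) _).
  move=> s /= [/andP[_ s1] sn]; split.
    exact: leq_trans (size_le_sumn s1) sn.
  by apply: sub_all (all_le_sumn s) => y /= ys; apply: leq_trans ys sn.
by move=> x /= xn; exists (Ordinal (xn : x < n.+1)).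
Qed.

Lemma finite_distinct_overpartitions_le (n : nat) :
  finite_set [set l | is_distinct_overpartition l /\ sumn (unzip1 l) <= n].
Proof.
pose g (x : 'I_n.+1 * bool) := (val x.1, x.2).
apply: sub_finite_set
  (@finite_bounded_seq _ _ g n (fun x => x.1 <= n) _); last first.
  by case=> x b /= xn; exists (Ordinal (xn : x < n.+1), b).
move=> l /= [/andP[_ l1] ln]; split.
  by rewrite -(size_map fst); apply: leq_trans (size_le_sumn l1) ln.
have := all_le_sumn (unzip1 l); rewrite all_map.
by apply: sub_all => y /= ys; apply: leq_trans ys ln.
Qed.

Lemma finite_partitions_missing (n m : nat) :
  finite_set (partitions_missing n m).
Proof.
by apply: sub_finite_set (finite_partitions_le n) => s /= [sp <- _].
Qed.

Lemma finite_Abar (n m : nat) : finite_set (Abar n m).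
Proof.
apply: sub_finite_set (finite_setX (finite_distinct_overpartitions_le n)
                                   (finite_partitions_le n)).
by move=> [l u] /= [ld up <- _]; rewrite leq_addr leq_addl.
Qed.

Lemma finite_Abar_even (n m : nat) : finite_set (Abar_even n m).
Proof. by apply: sub_finite_set (finite_Abar n m) => lu []. Qed.

Lemma finite_Abar_odd (n m : nat) : finite_set (Abar_odd n m).
Proof. by apply: sub_finite_set (finite_Abar n m) => lu []. Qed.

(* Main.v *)
Require Import Defs.
From mathcomp Require Import finmap boolp classical_sets functions cardinality.
From mathcomp Require Import all_boot all_order all_algebra zify.

(** Conjugation turns the missing integers of a partition into its repeated
    parts (the excess of the number of parts over the number of distinct part
    sizes), so P(n,m) counts the partitions of n with m repeated parts.

    On the right-hand side a sign-reversing involution moves a part k between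
    the overlined parts of lambda and the parts of mu, where k is the smallest
    integer that is overlined in lambda, or is a part of mu whose size does not
    occur in lambda. The set of eligible integers does not change under such a
    move, so the same k is chosen again. In the pairs without eligible integer,
    lambda has no overlined part and every part of mu occurs in lambda: these
    are the partitions cut into one copy of each part size (lambda) and the
    repeated parts (mu). *)

Set Implicit Arguments.
Unset Strict Implicit.
Unset Printing Implicit Defensive.

Local Open Scope classical_set_scope.

(** * Comparing cardinalities of finite sets *)

Lemma ncard_le_inj (T U : choiceType) (A : set T) (B : set U) (f : T -> U) :
  finite_set A -> finite_set B -> (forall x, A x -> B (f x)) ->
  (forall x y, A x -> A y -> f x = f y -> x = y) -> ncard A <= ncard B.
Proof.
move=> finA finB fAB f_inj.
have <- : #|` (f @` fset_set A)%fset| = ncard A.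
  apply: card_in_imfset => x y.
  by rewrite !in_fset_set // => /set_mem Ax /set_mem Ay; apply: f_inj.
apply: fsubset_leq_card; apply/fsubsetP => _ /imfsetP[x /= + ->].
by rewrite !in_fset_set // => /set_mem Ax; apply/mem_set/fAB.
Qed.

(** Being its own inverse on both sets, [f] is injective on each of them, which gives the two
    inequalities. *)
Lemma ncard_involution (T : choiceType) (A B : set T) (f : T -> T) :
  finite_set A -> finite_set B -> (forall x, A x -> B (f x)) ->
  (forall x, B x -> A (f x)) -> (forall x, A x \/ B x -> f (f x) = x) ->
  ncard A = ncard B.
Proof.
move=> finA finB fAB fBA fK.
apply/eqP; rewrite eqn_leq; apply/andP; split.
  apply: (ncard_le_inj finA finB fAB) => x y Ax Ay fxy.
  by rewrite -(fK x) ?fxy ?fK; auto.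
apply: (ncard_le_inj finB finA fBA) => x y Bx By fxy.
by rewrite -(fK x) ?fxy ?fK; auto.
Qed.

Lemma ncard_setD (T : choiceType) (A B : set T) :
  finite_set A -> ncard A = ncard (A `&` B) + ncard (A `\` B).
Proof.
move=> finA; have finAB := finite_setIl B finA.
(* [B] may be infinite, in which case [fset_set B] would be empty; its intersection with [A] is
   finite. *)
have -> : A `\` B = A `\` (A `&` B).
  apply/seteqP; split=> x [Ax nBx]; split=> //; first by case.
  by move=> Bx; apply: nBx.
rewrite /ncard fset_setD // -(cardfsID (fset_set (A `&` B)) (fset_set A)).
congr (_ + _); congr #|` _|; apply/fsetIidPr; rewrite -fset_set_sub //.
Qed.

(** * Conjugation of partitions *)

Lemma eq_ltn_nat a b : (forall i, (i < a) = (i < b)) -> a = b.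
Proof. by move=> e; have := e a; have := e b; lia. Qed.

Lemma geq_trans : transitive geq.
Proof. by move=> y x z /= yx zy; apply: leq_trans zy yx. Qed.

Lemma gtn_trans : transitive gtn.
Proof. by move=> y x z /= yx zy; apply: ltn_trans zy yx. Qed.

Lemma geq_anti : antisymmetric geq.
Proof. by move=> x y /=; lia. Qed.

Lemma geq_total : total geq.
Proof. by move=> x y /=; lia. Qed.

(** Both sides say that the cell in row [j] and column [i], numbered from 0, lies in the Ferrers
    diagram of [s]. The default 0 stands for the empty rows past the end. *)
Lemma ltn_nth_count s i j :
  sorted geq s -> (i < nth 0 s j) = (j < count (ltn i) s).
Proof.
elim: s j => [|x s IH] j /=; first by rewrite nth_nil.
rewrite (path_sortedE geq_trans) => /andP[/allP xs /IH{}IH].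
have [ix|xi] := ltnP i x; first by case: j.
rewrite (_ : count _ _ = 0); last first.
  by apply/eqP; rewrite -leqn0 leqNgt -has_count; apply/hasPn => y /xs /=; lia.
case: j => [|j] /=; first lia.
have [js|js] := ltnP j (size s); last by rewrite nth_default //.
by have /= := xs _ (mem_nth 0 js); lia.
Qed.

Definition conjugate (s : seq nat) : seq nat :=
  [seq count (ltn i) s | i <- iota 0 (head 0 s)].

Lemma nth_conjugate s i :
  sorted geq s -> nth 0 (conjugate s) i = count (ltn i) s.
Proof.
move=> s_sorted; have [ih|hi] := ltnP i (head 0 s).
  by rewrite (nth_map 0) ?size_iota // nth_iota.
(* Past the largest part the default 0 is the right value: no part exceeds [i]. *)
rewrite nth_default ?size_map ?size_iota //.
by move: hi; rewrite -nth0 leqNgt ltn_nth_count // -leqNgt leqn0 => /eqP.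
Qed.

Lemma size_conjugate s : size (conjugate s) = head 0 s.
Proof. by rewrite size_map size_iota. Qed.

Lemma is_partition_conjugate s :
  is_partition s -> is_partition (conjugate s).
Proof.
move=> /andP[s_sorted _]; apply/andP; split.
  apply: (homo_sorted (e := leq)); last exact: iota_sorted.
  by move=> i j ij; apply: sub_count => x /=; lia.
apply/allP => _ /mapP[i + ->]; rewrite mem_iota -nth0.
by rewrite ltn_nth_count.
Qed.

Lemma head_conjugate s : is_partition s -> head 0 (conjugate s) = size s.
Proof.
by move=> /andP[s_sorted s1]; rewrite -nth0 nth_conjugate //; apply/eqP;
  rewrite -all_count.
Qed.

(** Reflecting the diagram twice restores it: [ltn_nth_count] is used once for each reflection. *)
Lemma conjugateK s : is_partition s -> conjugate (conjugate s) = s.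
Proof.
move=> sp; have /andP[s_sorted _] := sp.
have /andP[c_sorted _] := is_partition_conjugate sp.
have sizeE : size (conjugate (conjugate s)) = size s.
  by rewrite size_conjugate head_conjugate.
apply: (eq_from_nth (x0 := 0) sizeE) => j _; apply: eq_ltn_nat => i.
by rewrite nth_conjugate // -ltn_nth_count // nth_conjugate // -ltn_nth_count.
Qed.

(** The cells of the diagram are counted by columns and by rows. By induction on the rows, a row of
    length [x <= h] adds one cell to exactly [x] of the [h] columns. *)
Lemma sumn_count_ltn h s :
  all (geq h) s -> sumn [seq count (ltn i) s | i <- iota 0 h] = sumn s.
Proof.
elim: s => [|x s IH] /=; first by move=> _; rewrite sumnE big_map big1.
move=> /andP[xh /IH <-].
have xE : sumn [seq (i < x : nat) | i <- iota 0 h] = x.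
  rewrite sumn_count -(subnKC xh) iotaD count_cat.
  rewrite (eq_in_count (a2 := predT)) ?count_predT ?size_iota; last first.
    by move=> i; rewrite mem_iota /= => ->.
  rewrite (eq_in_count (a2 := pred0)) ?count_pred0 ?addn0 //.
  by move=> i; rewrite mem_iota /=; lia.
by rewrite -{2}xE !sumnE !big_map -big_split.
Qed.

Lemma geq_head s : sorted geq s -> all (geq (head 0 s)) s.
Proof.
by case: s => //= x s; rewrite leqnn (path_sortedE geq_trans) => /andP[].
Qed.

Lemma sumn_conjugate s : is_partition s -> sumn (conjugate s) = sumn s.
Proof. by move=> /andP[/geq_head s_le _]; apply: sumn_count_ltn. Qed.

(* Each value [count (ltn i) s] is also [count (leq p) s], where [p] is the
   smallest part of [s] larger than [i]. *)
Lemma size_undup_conjugate_le s :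
  is_partition s -> size (undup (conjugate s)) <= size (undup s).
Proof.
move=> /andP[s_sorted s1].
rewrite -(size_map (fun p => count (ltn p.-1) s) (undup s)).
apply: uniq_leq_size; first exact: undup_uniq.
move=> c; rewrite mem_undup => /mapP[i]; rewrite mem_iota -nth0 => ih ->.
(* The [d] parts above [i] come first in [s], so entry [d.-1] is the smallest of them. *)
set d := count (ltn i) s; have d0 : 0 < d by rewrite -ltn_nth_count.
have dlt : d.-1 < size s.
  by have := count_size (ltn i) s; rewrite -/d; lia.
have ip : i < nth 0 s d.-1 by rewrite ltn_nth_count // -/d prednK.
have ps := mem_nth 0 dlt; move pE: (nth 0 s d.-1) ip ps => p ip ps.
apply/mapP; exists p; first by rewrite mem_undup.
apply/eqP; rewrite eqn_leq; apply/andP; split.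
  rewrite -(prednK d0) -ltn_nth_count // pE; lia.
by apply: sub_count => x /=; lia.
Qed.

(** The reverse inequality is the previous one applied to the conjugate. *)
Lemma size_undup_conjugate s :
  is_partition s -> size (undup (conjugate s)) = size (undup s).
Proof.
move=> sp; apply/eqP; rewrite eqn_leq size_undup_conjugate_le //=.
rewrite -{1}(conjugateK sp).
exact/size_undup_conjugate_le/is_partition_conjugate.
Qed.

(** * From missing integers to repeated parts *)

Lemma size_missing s :
  is_partition s -> size (missing s) + size (undup s) = head 0 s.
Proof.
move=> /andP[s_sorted s1]; have /allP s_le := geq_head s_sorted.
have maxE : \max_(p <- s) p = head 0 s.
  apply/eqP; rewrite eqn_leq; apply/andP; split.
    by apply/bigmax_leqP_seq => p ps _; apply: s_le.
  by case: (s) => //= x t; rewrite big_cons leq_maxl.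
rewrite /missing maxE.
case: s s_sorted s1 s_le {maxE} => //= x s s_sorted /andP[x1 s1] s_le.
(* The largest part [x] is not missing, so it can join the range; the range from 1 to [x] then
   splits into the distinct parts and the missing integers. *)
have -> : [seq i <- index_iota 1 x | i \notin x :: s]
  = [seq i <- index_iota 1 x.+1 | i \notin x :: s].
  rewrite /index_iota subSS subn0 subn1.
  have -> : iota 1 x = iota 1 x.-1 ++ [:: x].
    by rewrite -{1}(prednK x1) -[_.-1.+1]addn1 iotaD /= add1n prednK.
  by rewrite filter_cat /= mem_head cats0.
suff /perm_size <- : perm_eq [seq i <- index_iota 1 x.+1 | i \in x :: s]
    (undup (x :: s)).
  by rewrite !size_filter addnC count_predC size_iota subSS subn0.
apply: uniq_perm; rewrite ?undup_uniq ?filter_uniq ?iota_uniq // => p.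
rewrite mem_filter mem_undup mem_index_iota andb_idr // => ps.
have /allP /(_ p ps) p1 : all (leq 1) (x :: s) by rewrite /= x1.
by have /= := s_le p ps; rewrite ltnS p1.
Qed.

Definition partitions_repeated (n m : nat) : set (seq nat) :=
  [set s | [/\ is_partition s, sumn s = n & size s = size (undup s) + m]].

Lemma finite_partitions_repeated (n m : nat) :
  finite_set (partitions_repeated n m).
Proof.
by apply: sub_finite_set (finite_partitions_le n) => s /= [sp <- _].
Qed.

(** Conjugation swaps the largest part with the number of parts and keeps the number of distinct
    parts; by [size_missing], the difference of the former and the latter counts missing
    integers. *)
Lemma P_repeated (n m : nat) : P n m = ncard (partitions_repeated n m).
Proof.
apply: (ncard_involution (f := conjugate)).
- exact: finite_partitions_missing.
- exact: finite_partitions_repeated.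
- move=> s [sp sn sm]; split; first exact: is_partition_conjugate.
    by rewrite sumn_conjugate.
  by rewrite size_conjugate size_undup_conjugate // -size_missing // sm addnC.
- move=> s [sp sn sm]; split; first exact: is_partition_conjugate.
    by rewrite sumn_conjugate.
  have := size_missing (is_partition_conjugate sp).
  by rewrite head_conjugate // size_undup_conjugate // sm; lia.
by move=> s [[sp _ _]|[sp _ _]]; apply: conjugateK.
Qed.

(** * Moving a part between the two components of a pair *)

Notation overpair := (seq (nat * bool) * seq nat)%type.

(** The weak order is total, as sorting requires; strict decrease is recovered from the distinctness
    of the sizes. *)
Definition by_size : rel (nat * bool) := relpre fst geq.

Definition valid_pair (lu : overpair) : bool :=
  is_distinct_overpartition lu.1 && is_partition lu.2.

Lemma is_distinct_overpartitionE l :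
  is_distinct_overpartition l =
  [&& uniq (unzip1 l), sorted by_size l & all (leq 1) (unzip1 l)].
Proof.
by rewrite /is_distinct_overpartition gtn_sorted_uniq_geq sorted_map -andbA.
Qed.

Lemma is_distinct_overpartition_cons k b l :
  is_distinct_overpartition l -> 0 < k -> k \notin unzip1 l ->
  is_distinct_overpartition (sort by_size ((k, b) :: l)).
Proof.
rewrite !is_distinct_overpartitionE => /and3P[l_uniq _ l1] k0 kl.
have perm_l := perm_map fst (permEl (perm_sort by_size ((k, b) :: l))).
rewrite (perm_uniq perm_l) (perm_all _ perm_l) /= kl l_uniq k0 l1 !andbT.
by apply: sort_sorted => x y; apply: geq_total.
Qed.

Lemma is_distinct_overpartition_rem p l :
  is_distinct_overpartition l -> is_distinct_overpartition (rem p l).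
Proof.
move=> /andP[l_sorted l1]; apply/andP; split.
  exact: (subseq_sorted gtn_trans (map_subseq _ (rem_subseq p l)) l_sorted).
apply/allP => x /(mem_subseq (map_subseq _ (rem_subseq p l))).
exact: (allP l1).
Qed.

Lemma is_partition_sort s : all (leq 1) s -> is_partition (sort geq s).
Proof.
by move=> s1; rewrite /is_partition all_sort s1 sort_sorted //; apply: geq_total.
Qed.

Lemma is_partition_rem k s : is_partition s -> is_partition (rem k s).
Proof.
move=> /andP[s_sorted s1]; apply/andP; split.
  exact: (subseq_sorted geq_trans (rem_subseq k s) s_sorted).
by apply/allP => x /mem_rem; apply: (allP s1).
Qed.

Lemma partition_perm_eq s t :
  is_partition s -> is_partition t -> perm_eq s t -> s = t.
Proof.
move=> /andP[s_sorted _] /andP[t_sorted _].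
exact: (sorted_eq geq_trans geq_anti s_sorted t_sorted).
Qed.

Lemma gtn_sorted_eq (s t : seq nat) :
  sorted gtn s -> sorted gtn t -> s =i t -> s = t.
Proof.
by apply: (irr_sorted_eq gtn_trans) => x /=; apply: ltnn.
Qed.

Lemma distinct_overpartition_perm_eq l l' :
  is_distinct_overpartition l -> is_distinct_overpartition l' ->
  perm_eq l l' -> l = l'.
Proof.
move=> /andP[l_sorted _] /andP[l'_sorted _] /perm_mem ll'.
apply: (irr_sorted_eq (leT := relpre fst gtn)) => //.
- by move=> y x z; apply: gtn_trans.
- by move=> x /=; apply: ltnn.
- by rewrite -sorted_map.
by rewrite -sorted_map.
Qed.

(** A relation up to order, directed from lambda to mu. Both branches of [toggle] are instances of
    it, read forwards or backwards, so invariants are proved only once. *)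
Definition transfers (k : nat) (lu lu' : overpair) : bool :=
  perm_eq lu.1 ((k, true) :: lu'.1) && perm_eq lu'.2 (k :: lu.2).

Definition transferable (lu : overpair) (k : nat) : bool :=
  ((k, true) \in lu.1) || (k \in lu.2) && (k \notin unzip1 lu.1).

Definition toggle (k : nat) (lu : overpair) : overpair :=
  if (k, true) \in lu.1 then (rem (k, true) lu.1, sort geq (k :: lu.2))
  else (sort by_size ((k, true) :: lu.1), rem k lu.2).

Lemma toggle_to_partition k lu :
  valid_pair lu -> (k, true) \in lu.1 ->
  valid_pair (toggle k lu) && transfers k lu (toggle k lu).
Proof.
move=> /andP[l_dist u_part] kl; rewrite /toggle kl.
rewrite /valid_pair /transfers /= perm_to_rem // perm_sort perm_refl andbT /=.
rewrite is_distinct_overpartition_rem //= andbT.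
apply: is_partition_sort => /=; have /andP[_ ->] := u_part; rewrite andbT.
have /andP[_ /allP] := l_dist; apply.
exact: (map_f fst kl).
Qed.

Lemma toggle_to_overpartition k lu :
  valid_pair lu -> transferable lu k -> (k, true) \notin lu.1 ->
  valid_pair (toggle k lu) && transfers k (toggle k lu) lu.
Proof.
move=> /andP[l_dist u_part]; rewrite /transferable /toggle.
case: ifP => //= _ /andP[ku kl] _.
rewrite /valid_pair /transfers /= perm_to_rem // perm_sort perm_refl !andbT.
rewrite is_partition_rem // andbT is_distinct_overpartition_cons //.
by have /andP[_ /allP] := u_part; apply.
Qed.

Section Transfers.
Variables (k : nat) (lu lu' : overpair).
Hypothesis tr : transfers k lu lu'.

Lemma transfers_notin : valid_pair lu -> k \notin unzip1 lu'.1.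
Proof.
move=> luP.
have /andP[+ _] := luP; rewrite is_distinct_overpartitionE => /and3P[+ _ _].
by have /andP[/(perm_map fst)/perm_uniq-> _] := tr; rewrite /= => /andP[].
Qed.

Lemma transfers_mem : (k, true) \in lu.1.
Proof. by have /andP[/perm_mem-> _] := tr; rewrite mem_head. Qed.

(** Nothing changes for [j] other than [k]. As for [k], it is overlined before the move; after it,
    [k] is a part of mu and its size has left lambda. *)
Lemma transfers_transferable :
  valid_pair lu -> transferable lu =1 transferable lu'.
Proof.
move=> luP j; rewrite /transferable.
have /andP[pl pu] := tr.
rewrite (perm_mem pl) (perm_mem (perm_map fst pl)) (perm_mem pu) /= !inE.
have [->|jk] := eqVneq j k; first by rewrite eqxx transfers_notin // orbT.
by rewrite xpair_eqE (negPf jk).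
Qed.

Lemma transfers_overlined : overlined lu.1 = (overlined lu'.1).+1.
Proof. by have /andP[/permP/(_ snd) + _] := tr; rewrite /overlined /= => ->. Qed.

Lemma transfers_sumn :
  sumn (unzip1 lu.1) + sumn lu.2 = sumn (unzip1 lu'.1) + sumn lu'.2.
Proof.
have /andP[/(perm_map fst)/perm_sumn-> /perm_sumn->] := tr.
by rewrite /= -/(unzip1 _); lia.
Qed.

Lemma transfers_size : size lu'.2 = (size lu.2).+1.
Proof. by have /andP[_ /perm_size] := tr. Qed.

End Transfers.

Lemma AbarE n m lu : Abar n m lu <->
  [/\ valid_pair lu, sumn (unzip1 lu.1) + sumn lu.2 = n
    & overlined lu.1 + size lu.2 = m].
Proof.
split=> [[l_dist u_part sum_n sz]|[/andP[l_dist u_part] sum_n sz]].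
  by split; rewrite ?/valid_pair ?l_dist //; lia.
by split=> //; lia.
Qed.

(** The overlined part lost by lambda is offset by the part gained by mu, both in the total size and
    in the count that equals [m]. *)
Lemma transfers_Abar n m k lu lu' :
  valid_pair lu -> valid_pair lu' -> transfers k lu lu' ->
  Abar n m lu <-> Abar n m lu'.
Proof.
move=> luP lu'P tr; have := transfers_sumn tr.
have := transfers_size tr; have := transfers_overlined tr => ol sz sm.
by split=> /AbarE[_ sum_n sz_m]; apply/AbarE; split=> //; lia.
Qed.

Lemma valid_pair_perm_eq lu lu' :
  valid_pair lu -> valid_pair lu' ->
  perm_eq lu.1 lu'.1 -> perm_eq lu.2 lu'.2 -> lu = lu'.
Proof.
case: lu lu' => [l u] [l' u'] /andP[/= lP uP] /andP[/= l'P u'P] pl pu.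
by rewrite (distinct_overpartition_perm_eq lP l'P pl) (partition_perm_eq uP u'P).
Qed.

Lemma transfers_injr k a b c : valid_pair b -> valid_pair c ->
  transfers k a b -> transfers k a c -> b = c.
Proof.
move=> bP cP /andP[pl pu] /andP[pl' pu']; apply: valid_pair_perm_eq => //.
  by rewrite -(perm_cons (k, true)) -(permPl pl).
by rewrite (permPl pu) perm_sym.
Qed.

Lemma transfers_injl k a b c : valid_pair b -> valid_pair c ->
  transfers k b a -> transfers k c a -> b = c.
Proof.
move=> bP cP /andP[pl pu] /andP[pl' pu']; apply: valid_pair_perm_eq => //.
  by rewrite (permPl pl) perm_sym.
by rewrite -(perm_cons k) -(permPl pu).
Qed.

Lemma toggleP k lu : valid_pair lu -> transferable lu k ->
  valid_pair (toggle k lu) /\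
  (transfers k lu (toggle k lu) \/ transfers k (toggle k lu) lu).
Proof.
move=> luP lu_k; have [kl|kl] := boolP ((k, true) \in lu.1).
  by have /andP[? ?] := toggle_to_partition luP kl; split; [|left].
by have /andP[? ?] := toggle_to_overpartition luP lu_k kl; split; [|right].
Qed.

Lemma toggle_transferable k lu :
  valid_pair lu -> transferable lu k ->
  transferable (toggle k lu) =1 transferable lu.
Proof.
move=> luP lu_k j; have [luP' [tr|tr]] := toggleP luP lu_k.
  by rewrite (transfers_transferable tr luP).
by rewrite (transfers_transferable tr luP').
Qed.

Lemma odd_overlined_toggle k lu :
  valid_pair lu -> transferable lu k ->
  odd (overlined (toggle k lu).1) = ~~ odd (overlined lu.1).
Proof.
move=> luP lu_k; have [luP' [tr|tr]] := toggleP luP lu_k.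
  by rewrite (transfers_overlined tr) /= negbK.
by rewrite (transfers_overlined tr).
Qed.

Lemma Abar_toggle n m k lu :
  transferable lu k -> Abar n m lu -> Abar n m (toggle k lu).
Proof.
move=> lu_k A_lu; have /AbarE[luP _ _] := A_lu.
have [luP' [tr|tr]] := toggleP luP lu_k.
  exact/(transfers_Abar n m luP luP' tr).
exact/(transfers_Abar n m luP' luP tr).
Qed.

(** The two toggles are transfers in opposite directions sharing an end, and a transfer determines
    each of its ends from the other. *)
Lemma toggleK k lu :
  valid_pair lu -> transferable lu k -> toggle k (toggle k lu) = lu.
Proof.
move=> luP lu_k.
have lu_k' : transferable (toggle k lu) k by rewrite toggle_transferable.
have [kl|kl] := boolP ((k, true) \in lu.1).
  have /andP[luP' tr] := toggle_to_partition luP kl.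
  have kl' : (k, true) \notin (toggle k lu).1.
    by apply: contra (transfers_notin tr luP) => /(map_f fst).
  have /andP[luP'' tr'] := toggle_to_overpartition luP' lu_k' kl'.
  exact: transfers_injl tr' tr.
have /andP[luP' tr] := toggle_to_overpartition luP lu_k kl.
have /andP[luP'' tr'] := toggle_to_partition luP' (transfers_mem tr).
exact: transfers_injr tr' tr.
Qed.

(** * The sign-reversing involution *)

Definition cancelling : set overpair := [set lu | exists k, transferable lu k].

(** A bounded search suffices by [transferable_leq]. The range starts at 0, so the index found is
    the integer itself. *)
Definition pivot (n : nat) (lu : overpair) : nat :=
  find (transferable lu) (iota 0 n.+1).

Definition pairing (n : nat) (lu : overpair) : overpair :=
  toggle (pivot n lu) lu.

Lemma transferable_leq n m k lu : Abar n m lu -> transferable lu k -> k <= n.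
Proof.
move=> /AbarE[_ <- _].
have u_le j : j \in lu.2 -> j <= sumn (unzip1 lu.1) + sumn lu.2.
  by move=> /(allP (all_le_sumn lu.2)) /= ju; apply: leq_trans ju (leq_addl _ _).
case/orP => [/(map_f fst) /= kl|/andP[/u_le //]].
exact: leq_trans (allP (all_le_sumn (unzip1 lu.1)) _ kl) (leq_addr _ _).
Qed.

Lemma pivot_transferable n m lu :
  Abar n m lu -> cancelling lu -> transferable lu (pivot n lu).
Proof.
move=> A_lu [k lu_k].
have has_k : has (transferable lu) (iota 0 n.+1).
  by apply/hasP; exists k; rewrite // mem_iota ltnS (transferable_leq A_lu lu_k).
have := nth_find 0 has_k; rewrite nth_iota //.
by move: has_k; rewrite has_find size_iota.
Qed.

Lemma pairingK n m lu :
  Abar n m lu -> cancelling lu -> pairing n (pairing n lu) = lu.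
Proof.
move=> A_lu c_lu; have lu_k := pivot_transferable A_lu c_lu.
have /AbarE[luP _ _] := A_lu.
rewrite /pairing {1}/pivot.
(* The eligible integers are unchanged, so the second search stops at the same pivot. *)
by rewrite (eq_find (toggle_transferable luP lu_k)) toggleK.
Qed.

Lemma pairing_cancelling n m lu :
  Abar n m lu -> cancelling lu -> cancelling (pairing n lu).
Proof.
move=> A_lu c_lu; have lu_k := pivot_transferable A_lu c_lu.
have /AbarE[luP _ _] := A_lu.
by exists (pivot n lu); rewrite toggle_transferable.
Qed.

(** An odd count is nonzero, and any overlined part is eligible. Hence all unpaired elements are
    even. *)
Lemma odd_cancelling lu : odd (overlined lu.1) -> cancelling lu.
Proof.
move=> odd_lu; have : has snd lu.1.
  by rewrite has_count; move: odd_lu; rewrite /overlined; case: count.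
by case/hasP=> -[k b] /= kl b1; exists k; rewrite /transferable -b1 kl.
Qed.

Lemma ncard_Abar_odd n m :
  ncard (Abar_odd n m) = ncard (Abar_even n m `&` cancelling).
Proof.
apply: (ncard_involution (f := pairing n)).
- exact: finite_Abar_odd.
- exact/finite_setIl/finite_Abar_even.
- move=> lu [A_lu odd_lu]; have c_lu := odd_cancelling odd_lu.
  have lu_k := pivot_transferable A_lu c_lu.
  have /AbarE[luP _ _] := A_lu.
  split; last exact: pairing_cancelling A_lu c_lu.
  by split; [exact: Abar_toggle|rewrite odd_overlined_toggle ?odd_lu].
- move=> lu [[A_lu even_lu] c_lu].
  have lu_k := pivot_transferable A_lu c_lu.
  have /AbarE[luP _ _] := A_lu.
  by split; [exact: Abar_toggle|rewrite odd_overlined_toggle].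
move=> lu [[A_lu /odd_cancelling c_lu]|[[A_lu _] c_lu]]; exact: pairingK A_lu c_lu.
Qed.

(** * Unpaired elements as partitions with repeated parts *)

Definition merge (lu : overpair) : seq nat := sort geq (unzip1 lu.1 ++ lu.2).

(** The complement of [undup]: [undup] keeps the last occurrence of each value, and this keeps all
    the others. *)
Fixpoint repeats (s : seq nat) : seq nat :=
  if s is x :: s' then
    if x \in s' then x :: repeats s' else repeats s'
  else [::].

Definition split_repeats (s : seq nat) : overpair :=
  ([seq (x, false) | x <- undup s], repeats s).

Lemma unzip1_split_repeats s : unzip1 (split_repeats s).1 = undup s.
Proof. by rewrite /unzip1 -map_comp map_id. Qed.

Lemma repeats_subseq s : subseq (repeats s) s.
Proof.
elim: s => //= x s IH; case: ifP => _ /=; first by rewrite eqxx.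
exact: subseq_trans IH (subseq_cons s x).
Qed.

Lemma perm_undup_repeats s : perm_eq (undup s ++ repeats s) s.
Proof.
elim: s => //= x s IH; case: ifP => _ /=; last by rewrite perm_cons.
by rewrite -cat1s perm_catCA /= perm_cons.
Qed.

Lemma not_cancellingP lu : ~ cancelling lu ->
  all (predC snd) lu.1 /\ {subset lu.2 <= unzip1 lu.1}.
Proof.
move=> lu_fix; split.
  apply/allP => -[k []] //= kl; case: lu_fix; exists k.
  by rewrite /transferable kl.
move=> k ku; apply: contra_notT lu_fix => kl; exists k.
by rewrite /transferable ku kl orbT.
Qed.

Lemma split_repeats_not_cancelling s : ~ cancelling (split_repeats s).
Proof.
case=> k /orP[/mapP[x _ []] //|/andP[/(mem_subseq (repeats_subseq s)) ks]].
by rewrite unzip1_split_repeats mem_undup ks.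
Qed.

Lemma merge_split_repeats s : is_partition s -> merge (split_repeats s) = s.
Proof.
move=> sp; have /andP[s_sorted s1] := sp.
rewrite /merge unzip1_split_repeats.
apply: partition_perm_eq => //; last by rewrite perm_sort perm_undup_repeats.
by apply: is_partition_sort; rewrite (perm_all _ (perm_undup_repeats s)).
Qed.

Lemma is_partition_merge lu : valid_pair lu -> is_partition (merge lu).
Proof.
move=> /andP[/andP[_ l1] /andP[_ u1]]; apply: is_partition_sort.
by rewrite all_cat l1.
Qed.

Lemma undup_merge lu :
  valid_pair lu -> ~ cancelling lu -> undup (merge lu) = unzip1 lu.1.
Proof.
move=> luP /not_cancellingP[_ ul].
have /andP[/andP[l_sorted _] _] := luP.
have /andP[m_sorted _] := is_partition_merge luP.
apply: gtn_sorted_eq => //.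
  rewrite gtn_sorted_uniq_geq undup_uniq /=.
  exact: (subseq_sorted geq_trans (undup_subseq _)).
move=> x; rewrite mem_undup mem_sort mem_cat orb_idr //.
exact: ul.
Qed.

(** By [undup_merge] the merged partition determines the sizes in lambda, none of which is
    overlined; removing them from the multiset of parts leaves mu. *)
Lemma merge_inj lu lu' :
  valid_pair lu -> valid_pair lu' -> ~ cancelling lu -> ~ cancelling lu' ->
  merge lu = merge lu' -> lu = lu'.
Proof.
move=> luP lu'P lu_fix lu'_fix eq_merge.
have eq_unzip : unzip1 lu.1 = unzip1 lu'.1.
  by rewrite -undup_merge // eq_merge undup_merge.
have plain (v : overpair) :
    ~ cancelling v -> v.1 = [seq (x, false) | x <- unzip1 v.1].
  move=> /not_cancellingP[/allP v_plain _].
  rewrite -map_comp -[LHS]map_id; apply/eq_in_map => -[x b] /v_plain /=.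
  by case: b.
apply: valid_pair_perm_eq => //; first by rewrite plain // eq_unzip -plain.
rewrite -(perm_cat2l (unzip1 lu.1)) {2}eq_unzip.
have := perm_refl (merge lu); rewrite {2}eq_merge.
by rewrite perm_sort perm_sym perm_sort perm_sym.
Qed.

Lemma partitions_repeated_merge n m lu :
  Abar n m lu -> ~ cancelling lu -> partitions_repeated n m (merge lu).
Proof.
move=> /AbarE[luP sum_n sz_m] lu_fix; split; first exact: is_partition_merge.
  by rewrite (perm_sumn (permEl (perm_sort _ _))) sumn_cat.
rewrite undup_merge // size_sort size_cat; congr (_ + _).
have [/allP plain _] := not_cancellingP lu_fix.
(* With no overlined part, [m] is just the number of parts of mu. *)
rewrite -sz_m /overlined (eq_in_count (a2 := pred0)) ?count_pred0 //.
by move=> p /plain /negPf.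
Qed.

Lemma Abar_split_repeats n m s :
  partitions_repeated n m s -> Abar_even n m (split_repeats s).
Proof.
move=> [sp sum_n sz_m]; have /andP[s_sorted s1] := sp.
have ol : overlined (split_repeats s).1 = 0.
  by rewrite /overlined count_map count_pred0.
split; last by rewrite ol.
have perm_s := perm_undup_repeats s.
apply/AbarE; rewrite ol unzip1_split_repeats; split.
- apply/andP; split; apply/andP; rewrite ?unzip1_split_repeats; split.
  + rewrite gtn_sorted_uniq_geq undup_uniq /=.
    exact: (subseq_sorted geq_trans (undup_subseq s)).
  + by apply/allP => x; rewrite mem_undup; apply: (allP s1).
  + exact: (subseq_sorted geq_trans (repeats_subseq s)).
  + by apply/allP => x /(mem_subseq (repeats_subseq s)); apply: (allP s1).
- by rewrite -sumn_cat (perm_sumn perm_s).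
by have := perm_size perm_s; rewrite size_cat sz_m => /addnI.
Qed.

Lemma ncard_not_cancelling n m :
  ncard (Abar_even n m `\` cancelling) = ncard (partitions_repeated n m).
Proof.
have finA : finite_set (Abar_even n m `\` cancelling).
  by apply: sub_finite_set (finite_Abar_even n m) => lu [].
have finR := finite_partitions_repeated n m.
apply/eqP; rewrite eqn_leq; apply/andP; split.
  apply: (ncard_le_inj (f := merge)) => //.
    by move=> lu [[A_lu _] lu_fix]; apply: partitions_repeated_merge.
  move=> lu lu' [[/AbarE[luP _ _] _] lu_fix] [[/AbarE[lu'P _ _] _] lu'_fix].
  exact: merge_inj.
apply: (ncard_le_inj (f := split_repeats)) => //.
  move=> s sR; split; first exact: Abar_split_repeats.
  exact: split_repeats_not_cancelling.
move=> s t [sp _ _] [tp _ _] eq_st.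
by rewrite -(merge_split_repeats sp) eq_st merge_split_repeats.
Qed.

Theorem mainTheorem1 (n m : nat) :
  ((P n m)%:Z = (ncard (Abar_even n m))%:Z - (ncard (Abar_odd n m))%:Z :> int)%R.
Proof.
(* The even pairs split into the cancelling ones, as many as the odd pairs, and the others, counted
   by [P n m]. *)
rewrite P_repeated -ncard_not_cancelling ncard_Abar_odd.
rewrite (ncard_setD cancelling (finite_Abar_even n m)).
by rewrite PoszD GRing.addrC GRing.addKr.
Qed.
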